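(* Let $S$ be a spider with $d\ge 2$ legs and an odd number $n$ of vertices, having exactly two legs of odd length, of lengths $2k_1+1$ and $2k_2+1$ ($k_1,k_2\ge 0$), and $d-2$ legs of even lengths $2k_3,\ldots,2k_d$ ($k_3,\ldots,k_d\ge 1$). Then $$[e_{(3,\,2^{k_1+\cdots+k_d})}]X_S=4(k_1+k_2-k_3-\cdots-k_d)+2d-1.$$ In particular, if $d\ge 4$, $S$ has exactly two legs of odd length, and a longest leg of $S$ has even length, then $S$ is not $e$-positive.
   Context: A spider with legs of lengths $\lambda_1,\ldots,\lambda_d$ (positive integers) is the tree consisting of a vertex $v$ (the center) together with $d$ vertex-disjoint paths (legs) having $\lambda_1,\ldots,\lambda_d$ vertices respectively, where $v$ is joined by an edge to one endpoint of each leg; it has $1+\sum\lambda_i$ vertices. $(3,2^{k})$ denotes the partition with one part $3$ and $k$ parts $2$. The chromatic symmetric function of $G$ is $X_G=\sum_\kappa \prod_{v} x_{\kappa(v)}$ over proper colorings $\kappa$; $[e_\mu]X_G$ denotes the coefficient of $e_\mu$ in the expansion of $X_G$ in elementary symmetric functions; $G$ is $e$-positive if all these coefficients are nonnegative. *)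

(* Defs.v *)
From HB Require Import structures.
From mathcomp Require Import all_boot all_order all_algebra.
From mathcomp Require Import mpoly.
Set Implicit Arguments. Unset Strict Implicit. Unset Printing Implicit Defensive.
Import Order.TTheory GRing.Theory Num.Theory.
Local Open Scope ring_scope.

(* Spiders.  A spider with d legs of lengths lam 0, ..., lam (d-1).
   Vertices: None = the center; Some (Tagged i j) = the j-th vertex
   (j = 0 is the vertex adjacent to the center) of leg i.              *)
Definition spider_vertex (d : nat) (lam : 'I_d -> nat) : finType :=
  option {i : 'I_d & 'I_(lam i)}.

Definition spider_adj (d : nat) (lam : 'I_d -> nat)
  (x y : spider_vertex lam) : bool :=
  match x, y with
  | None, None => false
  | None, Some p => val (tagged p) == 0%N
  | Some p, None => val (tagged p) == 0%N
  | Some p, Some q =>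
      (tag p == tag q) &&
      (((val (tagged p)).+1 == val (tagged q)) || ((val (tagged q)).+1 == val (tagged p)))
  end.

Definition proper_coloring (V : finType) (adj : rel V) (N : nat)
  (kappa : {ffun V -> 'I_N}) : bool :=
  [forall u, forall v, adj u v ==> (kappa u != kappa v)].

Definition chromsym (V : finType) (adj : rel V) (N : nat) : {mpoly int[N]} :=
  \sum_(kappa : {ffun V -> 'I_N} | proper_coloring adj kappa)
     \prod_(v : V) 'X_(kappa v).

(* Integer partitions of N, encoded as nonincreasing N-tuples with entries
   in {0..N} summing to N (zeros are padding); the partition itself is the
   sequence of positive entries (a nonincreasing seq nat).              *)
Definition ptuple_ok (N : nat) (t : N.-tuple 'I_N.+1) : bool :=
  sorted geq [seq val x | x <- t] && (sumn [seq val x | x <- t] == N).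

Definition part_of (N : nat) (t : N.-tuple 'I_N.+1) : seq nat :=
  [seq x <- [seq val x | x <- t] | (0 < x)%N].

Definition elem_part (N : nat) (mu : seq nat) : {mpoly int[N]} :=
  \prod_(k <- mu) mesym N int k.

(* c : partitions -> int is the e-expansion of a degree-N symmetric
   polynomial p in N variables (N variables suffice: the restriction
   Lambda^N -> Z[x_1..x_N]^{S_N} is an isomorphism).                     *)
Definition e_expansion (N : nat) (p : {mpoly int[N]}) (c : seq nat -> int) :=
  p = \sum_(t : N.-tuple 'I_N.+1 | ptuple_ok t) c (part_of t) *: elem_part N (part_of t).

Definition e_positive (N : nat) (p : {mpoly int[N]}) :=
  exists c : seq nat -> int, e_expansion p c /\
    forall t : N.-tuple 'I_N.+1, ptuple_ok t -> 0 <= c (part_of t).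

Definition spider_size (d : nat) (lam : 'I_d -> nat) : nat :=
  (1 + \sum_(i < d) lam i)%N.

Definition X_spider (d : nat) (lam : 'I_d -> nat) : {mpoly int[spider_size lam]} :=
  chromsym (@spider_adj d lam) (spider_size lam).

(* Main.v *)
Require Import Defs.
From HB Require Import structures.
From mathcomp Require Import all_boot all_order all_fingroup all_algebra all_field.
From mathcomp Require Import mpoly ring zify.

(** Evaluating X_S at a point x turns it into a sum over the colour c of the center
    of x_c times a product of leg weights, which a linear recurrence computes.

    For the coefficient, take x = (1, -1 - X, X, 0, ..., 0) over Z[X]: then e_1 = 0,
    e_m = 0 for m > 3, e_2 = -(1 + X + X^2) and e_3 = -X (1 + X).  As n is odd, the
    coefficient of X^1 sees only the partition (3, 2^K), with the sign -(-1)^K,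
    and the leg weights are explicit modulo X^2.

    For the last part, let L be the longest leg.  If the other legs have at most L
    vertices in total, the coefficient is negative.  Otherwise n = 2a + 1 with all
    legs shorter than a.  Take x = -y with y the roots of T^n + T^(a+1) + T^a: all
    e_m(x) are 0 or 1, so an e-positive X_S would be nonnegative there.  Since the power
    sums p_m(y) vanish for 0 < m < a, a leg of length m has weight y_c^m, hence
    X_S(x) = -p_n(y) = -n. *)

Set Implicit Arguments. Unset Strict Implicit. Unset Printing Implicit Defensive.
Import Order.TTheory GRing.Theory Num.Theory.
Local Open Scope ring_scope.

(** * Weights of the proper colourings of one leg *)

Section LegWeight.
Variables (R : comNzRingType) (N : nat) (x : 'I_N -> R).

(** Total weight of the proper colourings of a leg of [m] vertices hung at a vertex of colour [c],
    that vertex itself not counted. *)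
Fixpoint leg_weight (m : nat) (c : 'I_N) : R :=
  if m is m'.+1 then \sum_(c' | c' != c) x c' * leg_weight m' c' else 1.

(** The sum is now the same for every [c], so at a given point it is evaluated only once. *)
Lemma leg_weightS m c :
  leg_weight m.+1 c = \sum_c' x c' * leg_weight m c' - x c * leg_weight m c.
Proof. by rewrite [X in X - _](bigD1 c) //= addrAC subrr add0r. Qed.

Definition neq_rel (a b : 'I_N) := a != b.

Lemma leg_weightE m c :
  leg_weight m c =
  \sum_(t : m.-tuple 'I_N | path neq_rel c t) \prod_(a <- t) x a.
Proof.
elim: m c => [|m IHm] c /=.
  rewrite (big_pred1 [tuple]) ?big_nil // => t.
  by rewrite [t]tuple0 /=; apply/esym/eqP.
under eq_bigr => c' _ do rewrite IHm big_distrr /=.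
rewrite (pair_big_dep (fun c' => c' != c)
  (fun c' (t : m.-tuple 'I_N) => path neq_rel c' t)
  (fun c' (t : m.-tuple 'I_N) => x c' * \prod_(a <- t) x a)) /=.
rewrite [RHS](reindex (fun p : 'I_N * m.-tuple 'I_N => [tuple of p.1 :: p.2])) /=.
  apply: eq_big => [[a t]|[a t] _] /=; first by rewrite /neq_rel [c == a]eq_sym.
  by rewrite big_cons.
exists (fun t : m.+1.-tuple 'I_N => (thead t, [tuple of behead t])) => [[a t]|t] _ /=.
  by congr pair; apply: val_inj.
by rewrite [RHS]tuple_eta; apply: val_inj.
Qed.

End LegWeight.

(** * Colourings of a spider, leg by leg *)

Section Spider.
Variables (d N : nat) (lam : 'I_d -> nat).

(** A dependent product, because the legs may have different lengths. *)
Let legs := fprod (fun i => (lam i).-tuple 'I_N).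

Definition join_coloring (p : 'I_N * legs) : {ffun spider_vertex lam -> 'I_N} :=
  [ffun v => if v is Some q then tnth (p.2 (tag q)) (tagged q) else p.1].

Definition split_coloring (kappa : {ffun spider_vertex lam -> 'I_N}) : 'I_N * legs :=
  (kappa None, fprod_of_fun (fun i => [tuple kappa (Some (Tagged _ j)) | j < lam i])).

Lemma join_coloringK : cancel join_coloring split_coloring.
Proof.
move=> [c g]; rewrite /split_coloring ffunE /=; congr pair.
apply/fprodP => i; rewrite fprodE; apply: eq_from_tnth => j.
by rewrite tnth_mktuple ffunE.
Qed.

Lemma split_coloringK : cancel split_coloring join_coloring.
Proof.
move=> kappa; apply/ffunP => -[[i j]|]; rewrite ffunE //=.
by rewrite fprodE tnth_mktuple.
Qed.

Lemma proper_join_coloring p :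
  proper_coloring (@spider_adj d lam) (join_coloring p) =
  [forall i, path (@neq_rel N) p.1 (p.2 i)].
Proof.
case: p => c g /=; apply/'forall_forallP/forallP => /= [H i | H u v].
  apply/(pathP c) => j; rewrite size_tuple => ltj.
  case: j ltj => [|j] ltj /=.
    have := H None (Some (Tagged _ (Ordinal ltj))).
    by rewrite !ffunE /= (tnth_nth c).
  have := H (Some (Tagged _ (Ordinal (ltnW ltj)))) (Some (Tagged _ (Ordinal ltj))).
  by rewrite !ffunE /= !eqxx /= !(tnth_nth c).
have H0 i (j : 'I_(lam i)) : val j = 0%N -> c != tnth (g i) j.
  move=> j0; have /(pathP c)/(_ 0%N) := H i.
  rewrite size_tuple (tnth_nth c) j0; apply.
  exact: leq_ltn_trans (ltn_ord j).
have H1 i (j j' : 'I_(lam i)) : (val j).+1 = val j' -> tnth (g i) j != tnth (g i) j'.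
  move=> jj'; have /(pathP c)/(_ (val j')) := H i.
  by rewrite size_tuple ltn_ord !(tnth_nth c) -[nat_of_ord j']/(val j') -jj' => /(_ isT).
apply/implyP.
case: u v => [[i j]|] [[i' j']|] //=; rewrite !ffunE //=.
- case/andP=> /eqP Ei; move: j'; case: i' / Ei => j' /=.
  by case/orP => /eqP /H1 //; rewrite eq_sym.
- by move/eqP/H0; rewrite eq_sym.
- by move/eqP/H0.
Qed.

End Spider.

(** Once the colour of the centre is fixed, the legs are coloured independently, so the sum over
    families of leg colourings is a product of sums. *)
Lemma mmap_chromsym_spider (R : comNzRingType) d N (lam : 'I_d -> nat) (x : 'I_N -> R) :
  mmap intr x (chromsym (@spider_adj d lam) N) =
  \sum_c x c * \prod_i leg_weight x (lam i) c.
Proof.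
rewrite /chromsym rmorph_sum /=.
under eq_bigr => kappa _ do
  (rewrite rmorph_prod /=; under eq_bigr => v _ do rewrite mmapX mmap1U).
rewrite (reindex (@join_coloring d N lam)); last first.
  by exists (@split_coloring d N lam) => p _;
    [apply: join_coloringK | apply: split_coloringK].
rewrite -(pair_big_dep xpredT
   (fun c g => proper_coloring (@spider_adj d lam) (join_coloring (c, g)))
   (fun c g => \prod_v x (join_coloring (c, g) v))) /=.
apply: eq_bigr => c _.
(* Improper leg colourings get weight 0, so that the sum runs over all families and can be
   distributed. *)
pose P i := [ffun t : (lam i).-tuple 'I_N =>
   if path (@neq_rel N) c t then \prod_(a <- t) x a else 0].
transitivity (x c * \sum_(g : fprod (fun i => (lam i).-tuple 'I_N)) \prod_(i in 'I_d) P i (g i)).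
  rewrite big_distrr [LHS]big_mkcond /=; apply: eq_bigr => g _.
  rewrite proper_join_coloring /=; case: ifP => [/forallP Hg | /forallPn [i ngi]].
    rewrite (bigD1 None) //= ffunE; congr (_ * _).
    rewrite (reindex_omap Some id) /=; last by case.
    transitivity (\prod_i \prod_(j < lam i) x (tnth (g i) j)).
      rewrite (sig_big_dep _ _ (fun i j => x (tnth (g i) j))) /=.
      by apply: eq_big => [[i j]|q _] /=; rewrite ?eqxx ?ffunE.
    apply: eq_bigr => i _.
    by rewrite ffunE Hg big_tuple.
  by rewrite (bigD1 i) //= ffunE (negPf ngi) mul0r mulr0.
congr (_ * _).
have -> := @big_fprod R 0 1 *%R +%R 'I_d (fun i => (lam i).-tuple 'I_N) P.
rewrite -(bigA_distr_big_dep _ (fun i j => untag 0 (P i) j)) /=.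
apply: eq_bigr => i _.
rewrite leg_weightE -(big_tag P) [RHS]big_mkcond /=; apply: eq_bigr => t _.
by rewrite ffunE.
Qed.

(** * Elementary symmetric polynomials at a point *)

Section EvalElementary.
Variables (R : idomainType) (N : nat) (x : 'I_N -> R).

(** Vieta's formula: [mroots_coeff] is used with the roots [- x i], whose signs cancel the sign it
    carries. *)
Lemma mmap_mesym k : (k <= N)%N ->
  mmap intr x (mesym N int k) = (\prod_i ('X + (x i)%:P))`_(N - k).
Proof.
move=> lekN; have := mroots_coeff [tuple - x i | i < N] (Ordinal (lekN : (k < N.+1)%N)).
rewrite big_tuple (eq_bigr (fun i => 'X + (x i)%:P)) => [->|i _]; last first.
  by rewrite tnth_mktuple polyCN opprK.
 rewrite /mesym !rmorph_sum mulr_sumr; apply: eq_bigr => h /eqP Eh /=.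
rewrite !rmorph_prod /=; under [in RHS]eq_bigr => i _ do
  rewrite mevalXU tnth_mktuple.
rewrite prodrN Eh mulrA -exprD addnn -mul2n exprM sqrrN expr1n expr1n mul1r.
by apply: eq_bigr => i _; rewrite mmapX mmap1U.
Qed.

Lemma mmap_e_expansion p c : e_expansion p c ->
  mmap intr x p = \sum_(t : N.-tuple 'I_N.+1 | ptuple_ok t)
    (c (part_of t))%:~R * \prod_(k <- part_of t) mmap intr x (mesym N int k).
Proof.
move=> ->; rewrite rmorph_sum /=; apply: eq_bigr => t _.
by rewrite mmapZ rmorph_prod.
Qed.

End EvalElementary.

(** * Partitions as zero-padded tuples *)

Section Partitions.
Variable N : nat.
Implicit Type t : N.-tuple 'I_N.+1.

Lemma sorted_geq_filter (s : seq nat) : sorted geq s ->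
  s = [seq i <- s | (0 < i)%N] ++ nseq (size s - size [seq i <- s | (0 < i)%N]) 0%N.
Proof.
elim: s => //= a s IHs pas; case: ltnP => [a_gt0|].
  by rewrite /= subSS -IHs // (path_sorted pas).
rewrite leqn0 => /eqP a0; rewrite {a}a0 in pas *.
have s0 : all (pred1 0%N) s.
  have := order_path_min (rev_trans leq_trans) pas.
  by apply: sub_all => i /=; rewrite leqn0.
rewrite (_ : [seq _ <- s | _] = [::]); last first.
  apply/eqP; rewrite -[_ == _]negbK -has_filter; apply/hasPn => i /(allP s0) /eqP -> //.
by rewrite /= (all_pred1P _ _ s0) size_nseq.
Qed.

(** The zeros come last and the length is fixed, so the positive entries determine the tuple. *)
Lemma part_of_inj : {in [pred t : N.-tuple 'I_N.+1 | ptuple_ok t] &, injective (@part_of N)}.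
Proof.
move=> t1 t2 /andP[/sorted_geq_filter s1 _] /andP[/sorted_geq_filter s2 _] E12.
apply/val_inj/(inj_map val_inj).
by rewrite /= in s1 s2; rewrite s1 s2 !size_map !size_tuple -/(part_of t1) -/(part_of t2) E12.
Qed.

Lemma part_ofP t : ptuple_ok t ->
  [/\ sorted geq (part_of t), all (ltn 0) (part_of t) & sumn (part_of t) = N].
Proof.
move=> /andP[srt /eqP sumt]; split; first by apply: sorted_filter srt; apply: (rev_trans leq_trans).
  exact: filter_all.
by rewrite -[RHS]sumt (sorted_geq_filter srt) sumn_cat sumn_nseq mul0n addn0.
Qed.

Lemma part_of_surj (mu : seq nat) :
  sorted geq mu -> all (ltn 0) mu -> sumn mu = N ->
  {t : N.-tuple 'I_N.+1 | ptuple_ok t & part_of t = mu}.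
Proof.
move=> srt pos sumN.
have le_size : (size mu <= N)%N.
  rewrite -sumN; elim: mu pos {srt sumN} => //= a mu IHmu /andP[a_gt0 /IHmu le].
  by rewrite -add1n leq_add.
have le_part i : (nth 0%N mu i <= N)%N.
  rewrite -sumN; elim: mu i {srt pos sumN le_size} => [|a mu IHmu] [|i] //=.
    by rewrite leq_addr.
  by rewrite (leq_trans (IHmu i)) // leq_addl.
(* No part exceeds [N], so [inord] keeps every entry; past the end of [mu] the default of [nth]
   supplies the padding. *)
pose t : N.-tuple 'I_N.+1 := [tuple inord (nth 0%N mu i) | i < N].
have Et : [seq val x | x <- t] = mu ++ nseq (N - size mu) 0%N.
  apply: (@eq_from_nth _ 0%N) => [|i].
    by rewrite size_cat size_nseq subnKC // size_map size_tuple.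
  rewrite size_map size_tuple => ltiN.
  rewrite (nth_map ord0) ?size_tuple // -[i]/(val (Ordinal ltiN)) -tnth_nth.
  rewrite tnth_mktuple /= inordK ?ltnS // nth_cat nth_nseq.
  by case: ltnP => // le; rewrite nth_default ?if_same.
have Ep : part_of t = mu.
  rewrite /part_of Et filter_cat (all_filterP pos) (_ : [seq _ <- nseq _ _ | _] = [::]) ?cats0 //.
  by elim: (N - _)%N.
exists t => //; rewrite /ptuple_ok Et sumn_cat sumn_nseq mul0n addn0 sumN eqxx andbT.
have zeros n a : path geq a (nseq n 0%N) by elim: n a => //= n IHn a; rewrite leq0n IHn.
case: (mu) srt => [_|a mu' srt] /=; first by case: (N - 0)%N => //= n; apply: zeros.
by rewrite cat_path zeros andbT.
Qed.

End Partitions.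

(** * The point (1, -1 - X, X, 0, ...) and the values of e_m there *)

Definition spec3 N (i : 'I_N) : {poly int} := [:: 1; - 1 - 'X; 'X]`_i.

(** The coefficient of T^(3-m) in (T + 1)(T - 1 - X)(T + X); the default 0 covers m > 3. *)
Definition spec3_e (m : nat) : {poly int} :=
  [:: 1; 0; - 1 - 'X - 'X^2; - ('X * (1 + 'X))]`_m.

Lemma sum_spec3 n (F : 'I_n.+3 -> {poly int}) :
  \sum_i spec3 i * F i =
  F (inord 0) - F (inord 1) - 'X * F (inord 1) + 'X * F (inord 2).
Proof.
rewrite !big_ord_recl big1 => [|i _]; last by rewrite /spec3 /= nth_nil mul0r.
rewrite /spec3 /= addr0 mul1r mulrBl mulN1r !addrA.
by do 4?[congr (_ + _)]; try (congr (- _)); try (congr (_ * _)); congr F;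
  apply: val_inj; rewrite /= inordK.
Qed.

Lemma mmap_mesym_spec3 N m : (2 < N)%N -> (m <= N)%N ->
  mmap intr (@spec3 N) (mesym N int m) = spec3_e m.
Proof.
case: N => [|[|[|n]]] // _ lemN; rewrite mmap_mesym //.
rewrite !big_ord_recl (eq_bigr (fun=> 'X)) => [|i _]; last first.
  by rewrite /spec3 /= nth_nil addr0.
rewrite prodr_const card_ord /spec3 /=.
(* The three nonzero coordinates give a cubic without T^2 term, the [n] zero ones the factor T^n. *)
have -> : ('X + 1%:P) * (('X + (- 1 - 'X)%:P) * (('X + 'X%:P) * 'X^n)) =
  ('X^3 + (- 1 - 'X - 'X^2)%:P * 'X + (- ('X * (1 + 'X)))%:P) * 'X^n :> {poly {poly int}}.
  rewrite !mulrA; congr (_ * _).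
  rewrite !(polyCB, polyCN, polyCM, polyCD, polyC_exp, polyC1) /=; ring.
rewrite coefMXn /spec3_e; case: ltnP => [lt|le].
  by rewrite nth_default //=; lia.
have le3 : (m <= 3)%N by lia.
rewrite (_ : _ - _ - _ = 3 - m)%N; last by lia.
rewrite !coefD coefXn coefMX !coefC.
by case: m le3 {lemN le} => [|[|[|[|m]]]] //= _; rewrite ?coefC ?mul0r ?addr0 ?add0r.
Qed.

Lemma sorted_geq_two_three (mu : seq nat) : sorted geq mu -> all (mem [:: 3; 2]%N) mu ->
  mu = nseq (count_mem 3 mu) 3%N ++ nseq (count_mem 2 mu) 2%N.
Proof.
elim: mu => //= a mu IHmu pmu /andP[a23 mu23].
have {}IHmu := IHmu (path_sorted pmu) mu23.
have mu_le := order_path_min (rev_trans leq_trans) pmu.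
move: a23; rewrite !inE => /orP[]/eqP Ea; rewrite {a}Ea in pmu mu_le *.
  by rewrite /= -IHmu.
have c3 : count_mem 3 mu = 0%N.
  by apply/eqP; rewrite -leqn0 leqNgt -has_count; apply/hasPn => i /(allP mu_le) /=; case: eqP => // ->.
by rewrite c3 /= in IHmu *; rewrite -IHmu.
Qed.

(** A part other than 2 and 3 makes the product vanish. Since the total is odd, some part is 3; each
    such part brings a factor X, so exactly one is allowed, and the constant terms of the remaining
    factors give the sign. *)
Lemma coef1_prod_spec3_e (K : nat) (mu : seq nat) :
  sorted geq mu -> all (ltn 0) mu -> sumn mu = (2 * K + 3)%N ->
  (\prod_(k <- mu) spec3_e k)`_1 =
    if mu == 3%N :: nseq K 2%N then - (-1) ^+ K else 0.
Proof.
move=> srt pos sumK.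
have [mu23|/allPn[k kmu k23]] := boolP (all (mem [:: 3; 2]%N) mu); last first.
  rewrite (big_rem k) //= (_ : spec3_e k = 0) ?mul0r ?coef0; last first.
    move: k23 (allP pos k kmu); rewrite /spec3_e.
    by case: k {kmu} => [|[|[|[|k]]]] //= _ _; rewrite nth_nil.
  case: eqP => // Emu; move: kmu k23; rewrite Emu !inE => /predU1P[->|/nseqP[->]] //.
have Emu := sorted_geq_two_three srt mu23.
move: (count_mem 3 mu) (count_mem 2 mu) Emu sumK => a b -> {srt pos mu23 mu}.
rewrite sumn_cat !sumn_nseq big_cat !big_nseq !iter_mulr_1 /= => sumK.
have [a1|a_neq1] := eqVneq a 1%N.
  have -> : b = K by lia.
  rewrite a1 eqxx expr1 /spec3_e /= mulNr coefN -mulrA coefXM /=.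
  by rewrite coef0M -!horner_coef0 !hornerE.
(* As 3a + 2b is odd, a is odd; not being 1, it is at least 2, and two factors e_3 are already
   divisible by X^2. *)
have [a'] : exists a', a = a'.+2 by exists a.-2; lia.
move=> Ea; rewrite {a}Ea in sumK a_neq1 *.
case: eqP => [/(congr1 (count_mem 3))|_].
  rewrite count_cat !count_nseq /= count_nseq; lia.
rewrite [X in X * _](_ : _ = 'X^2 * ((1 + 'X) ^+ 2 * spec3_e 3 ^+ a')); last first.
  rewrite !exprS /spec3_e /=; ring.
by rewrite -mulrA coefXnM.
Qed.

Lemma part_of_three_twos N K : N = (2 * K + 3)%N ->
  {t : N.-tuple 'I_N.+1 | ptuple_ok t & part_of t = 3%N :: nseq K 2%N}.
Proof.
move=> sizeN; apply: part_of_surj => /=; last by rewrite sumn_nseq sizeN; lia.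
  have path2 m a : (2 <= a)%N -> path geq a (nseq m 2%N).
    by elim: m a => // m IHm a a2; apply/andP; split; [exact: a2 | exact: IHm].
  exact: path2.
by rewrite all_nseq orbT.
Qed.

(** * Leg weights at this point, modulo X^2 *)

Section LegWeightSpec3.
Variable n : nat.

Let w := leg_weight (@spec3 n.+3).

Lemma leg_weight_spec3S m c :
  w m.+1 c = w m (inord 0) - w m (inord 1) - 'X * w m (inord 1) + 'X * w m (inord 2)
             - spec3 c * w m c.
Proof. by rewrite /w leg_weightS sum_spec3. Qed.

Lemma spec3_inord (i : nat) : (i < n.+3)%N ->
  spec3 (inord i : 'I_n.+3) = [:: 1; - 1 - 'X; 'X]`_i.
Proof. by rewrite /spec3 => lt; rewrite inordK. Qed.

(** Colour 2 has value X, so its constant term suffices. The linear coefficients are written as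
    constant term times a factor, the shape that [coef01_prod] needs. *)
Definition even_leg_spec3 (m : nat) (W : 'I_n.+3 -> {poly int}) :=
  [/\ (W (inord 0))`_0 = (-1) ^+ m, (W (inord 0))`_1 = (-1) ^+ m * (3 * m%:Z - 1),
      (W (inord 1))`_0 = (-1) ^+ m, (W (inord 1))`_1 = (-1) ^+ m * (1 - m%:Z)
    & (W (inord 2))`_0 = (-1) ^+ m * 2].

Definition odd_leg_spec3 (m : nat) (W : 'I_n.+3 -> {poly int}) :=
  [/\ (W (inord 0))`_0 = - (-1) ^+ m, (W (inord 0))`_1 = - (-1) ^+ m * - m%:Z,
      (W (inord 1))`_0 = (-1) ^+ m, (W (inord 1))`_1 = (-1) ^+ m * (3 * m%:Z + 1)
    & (W (inord 2))`_0 = 0].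

Let coefE := (coefD, coefB, coefN, coefXM, mulrBl, mulN1r, mul1r, spec3_inord).

Lemma even_leg_step m : odd_leg_spec3 m (w (2 * m).+1) ->
  even_leg_spec3 m.+1 (w (2 * m.+1)).
Proof.
rewrite (_ : (2 * m.+1 = (2 * m).+2)%N); last lia.
move=> [w00 w01 w10 w11 w20].
rewrite /even_leg_spec3 exprS; split; rewrite leg_weight_spec3S !coefE //= ?w00 ?w01 ?w10 ?w11 ?w20;
 rewrite -?natr1 ?intrD; ring.
Qed.

Lemma odd_leg_step m : even_leg_spec3 m.+1 (w (2 * m.+1)) ->
  odd_leg_spec3 m.+1 (w (2 * m.+1).+1).
Proof.
move=> [w00 w01 w10 w11 w20].
rewrite /odd_leg_spec3; split; rewrite leg_weight_spec3S !coefE //= ?w00 ?w01 ?w10 ?w11 ?w20;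
 rewrite -?natr1 ?intrD; ring.
Qed.

(** The induction starts at the leg with one vertex: the formulas for even lengths fail for the
    empty leg, whose weight is 1 at every colour. *)
Lemma odd_leg_weight m : odd_leg_spec3 m (w (2 * m).+1).
Proof.
elim: m => [|m IHm]; last exact/odd_leg_step/even_leg_step.
by split; rewrite leg_weight_spec3S /w /= !mulr1 !coefE //= !coefX !coef1.
Qed.

Lemma even_leg_weight m : even_leg_spec3 m.+1 (w (2 * m.+1)).
Proof. exact/even_leg_step/odd_leg_weight. Qed.

End LegWeightSpec3.

(** * The coefficient of e_(3, 2^K) *)

Lemma coef01_prod (I : finType) (F : I -> {poly int}) (s b : I -> int) :
  (forall i, (F i)`_0 = s i) -> (forall i, (F i)`_1 = s i * b i) ->
  (\prod_i F i)`_0 = \prod_i s i /\ (\prod_i F i)`_1 = (\prod_i s i) * \sum_i b i.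
Proof.
move=> F0 F1; elim/big_rec3: _ => [|i y1 y2 y3 _ [IH0 IH1]].
  by rewrite mulr0 !coef1.
rewrite coef0M coefM big_ord_recl big_ord1 /= F0 F1 IH0 IH1; split => //; ring.
Qed.

Lemma sum_ord_lt2 d : (2 <= d)%N -> (\sum_(i < d) (i < 2))%N = 2%N.
Proof. by case: d => [|[|d]] // _; rewrite !big_ord_recl big1. Qed.

Section OddOddEvenSpider.
Variables (d : nat) (lam k : 'I_d -> nat).
Hypotheses (d_ge2 : (2 <= d)%N)
  (lam_odd : forall i : 'I_d, (i < 2)%N -> lam i = (2 * k i).+1)
  (lam_even : forall i : 'I_d, (2 <= i)%N -> (1 <= k i)%N /\ lam i = (2 * k i)%N).

Let K := (\sum_(i < d) k i)%N.
Let Kodd : int := \sum_(i < d | (i < 2)%N) (k i)%:Z.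
Let Keven : int := \sum_(i < d | (2 <= i)%N) (k i)%:Z.

Lemma sum_k_split (u v : int) (f : 'I_d -> int) :
  (forall i : 'I_d, f i = if (i < 2)%N then u * (k i)%:Z else v * (k i)%:Z) ->
  \sum_i f i = u * Kodd + v * Keven.
Proof.
move=> Ef; rewrite (bigID (fun i : 'I_d => (i < 2)%N)) /= !mulr_sumr.
congr (_ + _); first by apply: eq_bigr => i i2; rewrite Ef i2.
apply: eq_big => [i|i i2]; first by rewrite -leqNgt.
by rewrite Ef (negPf i2).
Qed.

Lemma spider_size_odd_odd_even : spider_size lam = (2 * K + 3)%N.
Proof.
rewrite /spider_size (eq_bigr (fun i : 'I_d => 2 * k i + (i < 2))%N) => [|i _].
  by rewrite big_split /= sum_ord_lt2 // -big_distrr /= -/K; lia.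
by case: (ltnP i 2) => [/lam_odd|/lam_even []]; lia.
Qed.

Lemma coef1_chromsym_spec3 N : (2 < N)%N ->
  (mmap intr (@spec3 N) (chromsym (@spider_adj d lam) N))`_1 =
  - (-1) ^+ K * (4 * (Kodd - Keven) + 2 * d%:Z - 1).
Proof.
case: N => [|[|[|n]]] // _; rewrite mmap_chromsym_spider sum_spec3.
pose F c := \prod_i leg_weight (@spec3 n.+3) (lam i) c; rewrite -!/(F _).
pose s0 (i : 'I_d) : int := (-1) ^+ (i < 2)%N * (-1) ^+ k i.
pose b0 (i : 'I_d) : int := if (i < 2)%N then - (k i)%:Z else 3 * (k i)%:Z - 1.
pose b1 (i : 'I_d) : int := if (i < 2)%N then 3 * (k i)%:Z + 1 else 1 - (k i)%:Z.
(* There are two odd legs, so their extra signs at colour 0 cancel. *)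
have E0 : \prod_i s0 i = (-1) ^+ K.
  by rewrite big_split /= -!expr_sum sum_ord_lt2 // sqrrN expr1n mul1r.
have E1 : \prod_i (-1) ^+ k i = (-1) ^+ K :> int by rewrite -expr_sum.
have odd_leg (i : 'I_d) : (i < 2)%N -> @odd_leg_spec3 n (k i) (leg_weight (@spec3 n.+3) (lam i)).
  by move=> i2; rewrite lam_odd //; apply: odd_leg_weight.
have even_leg (i : 'I_d) : (2 <= i)%N -> @even_leg_spec3 n (k i) (leg_weight (@spec3 n.+3) (lam i)).
  by case/lam_even => + ->; case: (k i) => // m _; apply: even_leg_weight.
have [_ F0] : (F (inord 0))`_0 = \prod_i s0 i /\ (F (inord 0))`_1 = (\prod_i s0 i) * \sum_i b0 i.
  apply: coef01_prod => i; rewrite /s0 /b0; case: ltnP => i2;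
  by [case: (odd_leg i i2) => *; rewrite ?expr1 ?mulN1r | case: (even_leg i i2) => *; rewrite ?expr0 ?mul1r].
have [F1 F1'] : (F (inord 1))`_0 = \prod_i (-1) ^+ k i /\
    (F (inord 1))`_1 = (\prod_i (-1) ^+ k i) * \sum_i b1 i.
  apply: coef01_prod => i; rewrite /b1; case: (ltnP i 2) => i2;
  by [case: (odd_leg i i2) | case: (even_leg i i2)].
(* An odd leg has weight divisible by X at colour 2. *)
have F2 : (F (inord 2))`_0 = 0.
  rewrite coef0_prod (bigD1 (Ordinal (ltnW d_ge2))) //=.
  by case: (odd_leg (Ordinal (ltnW d_ge2)) isT) => _ _ _ _ ->; rewrite mul0r.
(* Adding 2, less 1 on the odd legs, turns each difference into -4 k_i on odd legs and 4 k_i on even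
   ones. *)
have Eb : \sum_i b0 i - \sum_i b1 i = - 4 * Kodd + 4 * Keven - 2 * d%:Z + 2.
  rewrite -(sum_k_split (f := fun i => b0 i - b1 i + 2 - (i < 2)%N%:Z)); last first.
    by move=> i; rewrite /b0 /b1; case: ltnP => _ /=; lia.
  rewrite sumrB big_split /= sumrB sumr_const card_ord.
  rewrite (_ : \sum_i (_ < 2)%N%:Z = 2); last first.
    by rewrite -(big_morph Posz PoszD (erefl _)) sum_ord_lt2.
  by rewrite -[2 *+ d]mulr_natr natz; ring.
rewrite !(coefD, coefB, coefN, coefXM) /= F0 F1 F1' F2 E0 E1 addr0.
have -> : \sum_i b0 i = \sum_i b1 i + (\sum_i b0 i - \sum_i b1 i) by ring.
rewrite Eb; ring.
Qed.

Lemma e_coef_odd_odd_even c : e_expansion (X_spider lam) c ->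
  c (3%N :: nseq K 2%N) = 4%:Z * (Kodd - Keven) + 2%:Z * d%:Z - 1.
Proof.
move=> /(mmap_e_expansion (@spec3 _)) /(congr1 (fun p : {poly int} => p`_1)).
have sizeN := spider_size_odd_odd_even.
have N_ge3 : (2 < spider_size lam)%N by rewrite sizeN; lia.
rewrite coef1_chromsym_spec3 //.
pose mu := 3%N :: nseq K 2%N.
have [t t_ok t_mu] := part_of_three_twos sizeN.
have coef_t (u : (spider_size lam).-tuple 'I_(spider_size lam).+1) : ptuple_ok u ->
    ((c (part_of u))%:~R * \prod_(j <- part_of u) mmap intr (@spec3 _) (mesym (spider_size lam) int j))`_1 =
    c (part_of u) * (if part_of u == mu then - (-1) ^+ K else 0).
  move=> u_ok; have [srt pos sumu] := part_ofP u_ok.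
  rewrite -(coef1_prod_spec3_e srt pos (etrans sumu sizeN)).
  rewrite mulrzl coefMrz -mulrzr mulrC.
  rewrite intz; congr (_ * (polyseq _)`_1); apply: eq_big_seq => j.
  rewrite mem_filter => /andP[_ /mapP[i _ ->]].
  exact: mmap_mesym_spec3 N_ge3 (leq_ord i).
(* Exactly one tuple encodes (3, 2^K), so a single term of the expansion survives. *)
rewrite coef_sum (eq_bigr _ coef_t) (bigD1 t) //= t_mu -/mu eqxx big1 ?addr0; last first.
  move=> u /andP[u_ok neq_ut]; case: eqP => [u_mu|_]; last by rewrite mulr0.
  by case/eqP: neq_ut; apply: part_of_inj => //; rewrite u_mu t_mu.
by rewrite mulrC => /mulIf <- //; rewrite oppr_eq0 signr_eq0.
Qed.

End OddOddEvenSpider.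

(** * Existence of the e-expansion *)

Lemma msymXU (R : comNzRingType) N (s : 'S_N) (i : 'I_N) :
  msym s 'X_i = 'X_(s i) :> {mpoly R[N]}.
Proof.
rewrite msymX; congr 'X_[_]; apply/mnmP => j; rewrite !mnmE.
by rewrite eq_sym (canF_eq (permKV s)) eq_sym.
Qed.

(** Permuting the colours permutes the proper colourings. *)
Lemma chromsym_sym (V : finType) (adj : rel V) N : chromsym adj N \is symmetric.
Proof.
apply/issymP => s; rewrite /chromsym rmorph_sum /=.
pose sk (u : 'S_N) (kappa : {ffun V -> 'I_N}) := [ffun v => u (kappa v)].
rewrite [RHS](reindex (sk s)) /=; last first.
  by exists (sk s^-1%g) => kappa _; apply/ffunP => v; rewrite !ffunE ?permK ?permKV.
apply: eq_big => kappa.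
  apply: eq_forallb => u; apply: eq_forallb => v.
  by rewrite !ffunE (inj_eq perm_inj).
by move=> _; rewrite rmorph_prod /=; apply: eq_bigr => v _; rewrite msymXU ffunE.
Qed.

Lemma chromsym_homog (V : finType) (adj : rel V) N : chromsym adj N \is #|V|.-homog.
Proof.
apply: rpred_sum => kappa _; rewrite mprodXE dhomogX /= mdeg_sum.
by under eq_bigr do rewrite mdeg1; rewrite sum1_card.
Qed.

Section EExpansionExists.
Variable N : nat.
Implicit Type u : N.-tuple 'I_N.+1.

(** Variable [i] stands for e_(i+1), so its exponent is the multiplicity of the part i + 1. *)
Definition mnm_of_seq (mu : seq nat) : 'X_{1..N} := [multinom count_mem i.+1 mu | i < N].

Lemma prod_seq_count (R : comNzRingType) (F : nat -> R) (mu : seq nat) :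
  all (fun a => 0 < a <= N)%N mu ->
  \prod_(a <- mu) F a = \prod_(i < N) F i.+1 ^+ count_mem i.+1 mu.
Proof.
elim: mu => [_|a mu IHmu /= /andP[/andP[a_gt0 leaN] /IHmu E]].
  by rewrite big_nil big1.
rewrite big_cons E; under [RHS]eq_bigr do rewrite exprD.
rewrite big_split /=; congr (_ * _).
case: a a_gt0 leaN {E} => // a _ ltaN.
rewrite (bigD1 (Ordinal ltaN)) //= eqxx expr1 big1 ?mulr1 // => i neq_i.
by rewrite eqSS eq_sym (negPf (neq_i : nat_of_ord i != a)) expr0.
Qed.

Lemma part_of_bounds u : all (fun a => 0 < a <= N)%N (part_of u).
Proof.
by apply/allP => a; rewrite mem_filter => /andP[-> /mapP[i _ ->]] /=; apply: leq_ord.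
Qed.

Lemma mnm_of_part_inj :
  {in [pred u : N.-tuple 'I_N.+1 | ptuple_ok u] &,
    injective (fun u => mnm_of_seq (part_of u))}.
Proof.
move=> u1 u2 ok1 ok2 /mnmP E12; apply: part_of_inj => //.
have [srt1 _ _] := part_ofP ok1; have [srt2 _ _] := part_ofP ok2.
apply: (sorted_eq (leT := geq)) srt1 srt2 _ => [||].
- exact: rev_trans leq_trans.
- by move=> a b; rewrite andbC; apply: anti_leq.
apply/allP => a; rewrite mem_cat => a12.
have /andP[a_gt0 leaN] : (0 < a <= N)%N.
  by case/orP: a12 => /(allP (part_of_bounds _)).
case: a a_gt0 leaN {a12} => // a _ ltaN.
by have := E12 (Ordinal ltaN); rewrite !mnmE => /= ->.
Qed.

Lemma mnm_of_part_surj (m : 'X_{1..N}) : mnmwgt m = N ->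
  {u : N.-tuple 'I_N.+1 | ptuple_ok u & mnm_of_seq (part_of u) = m}.
Proof.
move=> wgt_m; pose mu := flatten [seq nseq (m i) i.+1 | i : 'I_N].
have perm_mu : perm_eq (sort geq mu) mu by rewrite perm_sort.
have [|||u u_ok u_mu] := @part_of_surj N (sort geq mu).
- by apply: sort_sorted => a b; apply: leq_total.
- rewrite (perm_all _ perm_mu); apply/allP => a.
  by case/flattenP => _ /mapP[i _ ->] /nseqP[->].
- rewrite (perm_sumn perm_mu) -[RHS]wgt_m sumn_flatten -map_comp sumnE big_map big_enum.
  by apply: eq_bigr => i _ /=; rewrite sumn_nseq mulnC.
exists u => //; rewrite u_mu; apply/mnmP => i; rewrite mnmE (seq.permP perm_mu).
rewrite count_flatten -map_comp sumnE big_map big_enum /= (bigD1 i) //=.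
rewrite count_nseq /= eqxx mul1n big1 ?addn0 // => j neq_ji.
by rewrite count_nseq /= eqSS (negPf (neq_ji : nat_of_ord j != i)).
Qed.

(** By the fundamental theorem p = t(e_1, ..., e_N), where t is homogeneous of weight N if e_i has
    weight i; monomials of weight N correspond to partitions of N. *)
Lemma e_expansion_exists (p : {mpoly int[N]}) :
  p \is symmetric -> p \is N.-homog -> exists c, e_expansion p c.
Proof.
move=> sym_p hom_p; have [t [tp /dhomogP hom_t]] := sym_fundamental_homog sym_p hom_p.
exists (fun mu => t@_(mnm_of_seq mu)); rewrite /e_expansion -[LHS]tp comp_mpolyEX.
pose G m := t@_m *: \prod_(i < N) mesym N int i.+1 ^+ m i.
transitivity (\sum_(m <- msupp t) G m).
  apply: eq_bigr => m _; congr (_ *: _); rewrite comp_mpolyX; apply: eq_bigr => i _.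
  by rewrite tnth_mktuple.
transitivity (\sum_(u : N.-tuple 'I_N.+1 | ptuple_ok u) G (mnm_of_seq (part_of u))); last first.
  apply: eq_bigr => u _; congr (_ *: _).
  rewrite /elem_part prod_seq_count ?part_of_bounds //.
  by apply: eq_bigr => i _; rewrite mnmE.
(* The exponents coming from all partitions contain the support of [t], and the additional ones have
   coefficient 0. *)
pose oks := [seq mnm_of_seq (part_of u) | u <- enum [pred u : N.-tuple 'I_N.+1 | ptuple_ok u]].
transitivity (\sum_(m <- oks) G m); last by rewrite big_map big_enum.
rewrite [RHS](bigID (fun m => m \in msupp t)) /= [X in _ = _ + X]big1 ?addr0; last first.
  by move=> m m_t; rewrite /G memN_msupp_eq0 // scale0r.
rewrite -[RHS]big_filter; apply: perm_big; apply: uniq_perm; first exact: msupp_uniq.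
  rewrite filter_uniq // map_inj_in_uniq ?enum_uniq // => u1 u2.
  by rewrite !mem_enum; apply: mnm_of_part_inj.
move=> m; rewrite mem_filter; case: (boolP (m \in msupp t)) => //= m_t.
apply/esym/mapP; have [u u_ok <-] := mnm_of_part_surj (hom_t m m_t).
by exists u => //; rewrite mem_enum.
Qed.

End EExpansionExists.

Lemma X_spider_e_expansion d (lam : 'I_d -> nat) : exists c, e_expansion (X_spider lam) c.
Proof.
apply: e_expansion_exists; first exact: chromsym_sym.
have := chromsym_homog (@spider_adj d lam) (spider_size lam).
rewrite card_option card_tagged sumnE big_map big_enum /=.
by under eq_bigr do rewrite card_ord.
Qed.

(** * Newton's identities and the power sums of the roots of T^(2a+1) + T^(a+1) + T^a *)

Lemma deriv_prod_XsubC (F : fieldType) (s : seq F) :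
  (\prod_(z <- s) ('X - z%:P))^`() =
  \sum_(w <- s) (\prod_(z <- s) ('X - z%:P)) %/ ('X - w%:P).
Proof.
elim: s => [|z s IHs]; first by rewrite !big_nil derivC.
rewrite !big_cons derivM derivXsubC mul1r mulKp ?polyXsubC_eq0 // IHs big_distrr /=.
congr (_ + _); apply: eq_big_seq => w ws.
by rewrite divp_mulA // (big_rem w) //= dvdp_mulIl.
Qed.

(* Newton's identities, read off from P' = sum of P / ('X - w) over the roots w,
   where dividing by 'X - w telescopes. *)
Lemma newton_prod_XsubC (F : fieldType) (s : seq F) (j n : nat) :
  (size s <= j + n)%N ->
  (\prod_(z <- s) ('X - z%:P))^`()`_j =
  \sum_(l < n) (\prod_(z <- s) ('X - z%:P))`_(j.+1 + l) * \sum_(w <- s) w ^+ l.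
Proof.
move=> le_sz; rewrite deriv_prod_XsubC coef_sum.
under [RHS]eq_bigr do rewrite big_distrr /=.
rewrite exchange_big /=; apply: eq_big_seq => w ws.
set P := \prod_(z <- s) _; set Q := P %/ _.
have PQ : P = Q * ('X - w%:P).
  by rewrite divpK // /P (big_rem w) //= dvdp_mulIl.
(* The degree of [Q] is below [size s], so the far end of the telescoping sum vanishes. *)
have Q0 : Q`_(j + n) = 0.
  apply: nth_default; rewrite size_divp ?polyXsubC_eq0 // size_XsubC subn1.
  by rewrite size_prod_XsubC.
have step l : P`_(j.+1 + l) * w ^+ l = Q`_(j + l) * w ^+ l - Q`_(j + l.+1) * w ^+ l.+1.
  by rewrite PQ mulrBr coefB coefMC coefMX /= addnS exprS; ring.
under eq_bigr do rewrite step.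
rewrite -(big_mkord xpredT (fun l => Q`_(j + l) * w ^+ l - Q`_(j + l.+1) * w ^+ l.+1)).
rewrite (telescope_sumr_eq (fun l => - (Q`_(j + l) * w ^+ l))) // => [|l _].
  by rewrite Q0 mul0r oppr0 add0r opprK addn0 mulr1.
by rewrite opprK addrC.
Qed.

Section TrinomialRoots.
Variables (F : fieldType) (a : nat) (s : seq F).
Hypotheses (a_gt1 : (1 < a)%N)
  (prod_s : \prod_(z <- s) ('X - z%:P) = 'X^(2 * a + 1)%N + 'X^(a.+1) + 'X^a).

Let size_s : size s = (2 * a + 1)%N.
Proof.
apply: succn_inj; rewrite -(size_prod_XsubC s id) prod_s -addrA.
rewrite size_polyDl ?size_polyXn // size_polyDl ?size_polyXn //; lia.
Qed.

Let P : {poly F} := 'X^(2 * a + 1)%N + 'X^(a.+1) + 'X^a.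
Let p m := \sum_(w <- s) w ^+ m.

Let coefP i : P`_i = (i == 2 * a + 1)%N%:R + (i == a.+1)%N%:R + (i == a)%N%:R.
Proof. by rewrite !coefD !coefXn. Qed.

Let coefP0 i : (a.+1 < i < 2 * a + 1)%N -> P`_i = 0.
Proof.
move=> ia; rewrite coefP (_ : _ == _ = false); last lia.
rewrite (_ : (i == a.+1) = false); last lia.
by rewrite (_ : (i == a) = false) ?addr0 //; lia.
Qed.

(** Newton's identity at degree 2a - m, where the leading coefficient 1 isolates [p m]. *)
Lemma trinomial_newton m : (0 < m <= 2 * a)%N ->
  P`_(2 * a + 1 - m) *+ (2 * a + 1 - m) =
  \sum_(l < m) P`_(2 * a + 1 - m + l) * p l + p m.
Proof.
move=> m_le; have E : (2 * a + 1 - m = (2 * a - m).+1)%N by lia.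
transitivity (\sum_(l < m.+1) P`_(2 * a + 1 - m + l) * p l).
  by rewrite E -coef_deriv /P -prod_s (newton_prod_XsubC (n := m.+1)) // size_s; lia.
rewrite big_ord_recr /= subnK; last lia.
rewrite [X in X * p m]coefP eqxx (_ : (_ == a.+1) = false); last lia.
rewrite (_ : (_ == a) = false); last lia.
by rewrite !addr0 mul1r.
Qed.

(** Only coefficients of degree strictly between a + 1 and 2a + 1 enter, and these vanish. *)
Lemma trinomial_powersum_lt m : (0 < m < a)%N -> p m = 0.
Proof.
move=> ma; have := @trinomial_newton m; rewrite coefP0; last lia.
rewrite big1 => [|l _]; last first.
  by rewrite coefP0 ?mul0r //; have := ltn_ord l; lia.
by rewrite mul0rn add0r => <- //; lia.
Qed.

Let p0 : p 0 = (2 * a + 1)%:R.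
Proof.
rewrite /p; under eq_bigr do rewrite expr0.
by rewrite big_const_seq count_predT size_s iter_addr_0.
Qed.

Let coefPa1 : P`_a.+1 = 1.
Proof.
rewrite coefP eqxx (_ : (_ == 2 * a + 1)%N = false); last lia.
by rewrite (_ : (_ == a) = false) ?add0r ?addr0 //; lia.
Qed.

Let coefPa : P`_a = 1.
Proof.
rewrite coefP eqxx (_ : (_ == 2 * a + 1)%N = false); last lia.
by rewrite (_ : (_ == a.+1) = false) ?add0r //; lia.
Qed.

Lemma trinomial_powersum_mid : p a = - a%:R.
Proof.
have := @trinomial_newton a; rewrite (_ : 2 * a + 1 - a = a.+1)%N; last lia.
(* Only l = 0 survives, leaving a + 1 = (2a + 1) + p_a. *)
rewrite (bigD1 (Ordinal (ltnW a_gt1))) //= addn0 coefPa1 p0 big1 => [|l neq_l0]; last first.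
  have l_neq0 : nat_of_ord l != 0%N by [].
  by rewrite coefP0 ?mul0r //; have := ltn_ord l; lia.
rewrite mul1r addr0 => H; have {}H := H ltac:(lia).
apply: (addrI (2 * a + 1)%N%:R); rewrite -H.
rewrite (_ : 2 * a + 1 = a.+1 + a)%N ?natrD ?addrK //; lia.
Qed.

Lemma trinomial_powersum_mid1 : p a.+1 = - a.+1%:R.
Proof.
have := @trinomial_newton a.+1; rewrite (_ : 2 * a + 1 - a.+1 = a)%N; last lia.
rewrite (bigD1 ord0) //= addn0 coefPa p0 big1 => [|l neq_l0]; last first.
  have l_neq0 : nat_of_ord l != 0%N by [].
  (* The coefficient of T^(a+1) is 1, but it multiplies p_1, which is 0 because a > 1. *)
  have [->|l_neq1] := eqVneq (nat_of_ord l) 1%N.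
    by rewrite trinomial_powersum_lt ?mulr0.
  by rewrite coefP0 ?mul0r //; have := ltn_ord l; lia.
rewrite mul1r addr0 => H; have {}H := H ltac:(lia).
apply: (addrI (2 * a + 1)%N%:R); rewrite -H.
rewrite (_ : 2 * a + 1 = a + a.+1)%N ?natrD ?addrK //; lia.
Qed.

(** Every root satisfies w^(2a+1) = - w^(a+1) - w^a; sum over the roots. *)
Lemma trinomial_powersum_last : p (2 * a + 1)%N = (2 * a + 1)%:R.
Proof.
transitivity (- p a.+1 - p a).
  rewrite /p -opprD -big_split /= -sumrN; apply: eq_big_seq => w ws.
  have : root (\prod_(z <- s) ('X - z%:P)) w by rewrite root_prod_XsubC.
  rewrite prod_s rootE !hornerE -addrA addr_eq0 => /eqP; exact.
rewrite trinomial_powersum_mid trinomial_powersum_mid1 !opprK -natrD; congr _%:R; lia.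
Qed.

End TrinomialRoots.

(** * Failure of e-positivity *)

(* A case of the criterion that an e-positive connected graph has a connected
   partition of every type: the type (a+1, a) is missing here. *)
Lemma not_e_positive_short_legs d (lam : 'I_d -> nat) (a : nat) :
  (1 < a)%N -> spider_size lam = (2 * a + 1)%N -> (forall i, lam i < a)%N ->
  ~ e_positive (X_spider lam).
Proof.
move=> a_gt1 sizeN lam_lt [c [cX c_ge0]].
have [s] := closed_field_poly_normal ('X^(2 * a + 1)%N + 'X^(a.+1) + 'X^a : {poly algC}).
set P := _ + _.
have size_lt : (size ('X^(a.+1) + 'X^a : {poly algC})%R < size ('X^(2 * a + 1)%N : {poly algC}))%N.
  by rewrite size_polyDl ?size_polyXn //; lia.
have -> : lead_coef P = 1 by rewrite /P -addrA lead_coefDl // lead_coefXn.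
rewrite scale1r => /esym prod_s.
have size_s : size s = spider_size lam.
  apply: succn_inj; rewrite -(size_prod_XsubC s id) prod_s /P -addrA.
  by rewrite size_polyDl // size_polyXn sizeN.
pose y (i : 'I_(spider_size lam)) := s`_i.
have sum_y (f : algC -> algC) : \sum_i f (y i) = \sum_(w <- s) f w.
  by rewrite [RHS](big_nth 0) size_s big_mkord.
(* In the recurrence the common sum is, up to sign, a power sum of positive exponent below a, hence
   0; only the diagonal term remains. *)
have weight m i : (m < a)%N -> leg_weight (fun j => - y j) m i = y i ^+ m.
  elim: m i => [|m IHm] i ma; first by rewrite expr0.
  rewrite leg_weightS IHm ?(ltnW ma) // (eq_bigr (fun j => - y j ^+ m.+1)) => [|j _].
    rewrite sumrN (sum_y (fun w => w ^+ m.+1)) (trinomial_powersum_lt a_gt1 prod_s) //.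
    by rewrite oppr0 add0r mulNr opprK -exprS.
  by rewrite IHm ?(ltnW ma) // mulNr -exprS.
have := mmap_e_expansion (fun j => - y j) cX.
rewrite mmap_chromsym_spider (eq_bigr (fun i => - y i ^+ (2 * a + 1)%N)) => [|i _]; last first.
  rewrite (eq_bigr (fun j => y i ^+ lam j)) => [|j _]; last by rewrite weight.
  by rewrite -expr_sum mulNr -exprS -sizeN.
rewrite sumrN (sum_y (fun w => w ^+ _)) (trinomial_powersum_last a_gt1 prod_s).
move=> E; suff : 0 <= - (2 * a + 1)%N%:R :> algC by rewrite oppr_ge0 lern0 addn1.
rewrite E; apply: sumr_ge0 => t t_ok; apply: mulr_ge0; first by rewrite ler0z c_ge0.
rewrite big_seq; apply: prodr_ge0 => j /(allP (part_of_bounds t)) /andP[_ le_j].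
(* At -y each e_j is a coefficient of [P], hence nonnegative. *)
rewrite mmap_mesym //; under eq_bigr do rewrite polyCN.
have -> : \prod_(i < spider_size lam) ('X - (y i)%:P) = P.
  by rewrite -prod_s [RHS](big_nth 0) size_s big_mkord.
by rewrite /P !coefD !coefXn !addr_ge0 ?ler0n.
Qed.

(** Besides leg [i] there are d - 3 even legs, each contributing at least 1. *)
Lemma sum_even_legs_ge d (k : 'I_d -> nat) (i : 'I_d) :
  (2 <= i)%N -> (forall j : 'I_d, (2 <= j)%N -> (1 <= k j)%N) ->
  (k i + d <= \sum_(j < d | 2 <= j) k j + 3)%N.
Proof.
move=> i2 k_gt0; have d_ge2 : (2 <= d)%N by apply: leq_trans (ltnW (ltn_ord i)).
have Ed : (\sum_(j < d | 2 <= j) 1 + 2 = d)%N.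
  transitivity #|'I_d|; last exact: card_ord.
  rewrite -sum1_card [RHS](bigID (fun j : 'I_d => 2 <= j)%N) /=.
  congr (_ + _)%N; rewrite -[LHS](sum_ord_lt2 d_ge2) [RHS]big_mkcond /=.
  by apply: eq_bigr => j _; case: ltnP.
have -> : (\sum_(j < d | 2 <= j) k j = \sum_(j < d | 2 <= j) 1 + \sum_(j < d | 2 <= j) (k j).-1)%N.
  by rewrite -big_split /=; apply: eq_bigr => j /k_gt0; case: (k j).
rewrite [X in (_ <= _ + X + _)%N](bigD1 i) //=.
move: (\sum_(j < d | 1 < j) 1)%N Ed => S Ed; move: (\sum_(_ < d | _ && _) _)%N (k_gt0 i i2) => T.
lia.
Qed.


(* Legs are indexed by 'I_d; legs 0 and 1 are the two odd legs
   (lengths 2 k_0 + 1, 2 k_1 + 1), the others are even (lengths 2 k_i, k_i >= 1). *)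
Theorem theorem5p3 (d : nat) (lam k : 'I_d -> nat) :
  (2 <= d)%N ->
  (forall i : 'I_d, (i < 2)%N -> lam i = (2 * k i).+1) ->
  (forall i : 'I_d, (2 <= i)%N -> (1 <= k i)%N /\ lam i = (2 * k i)%N) ->
  odd (spider_size lam) ->
  (exists c, e_expansion (X_spider lam) c) /\
  (forall c, e_expansion (X_spider lam) c ->
     c (3%N :: nseq (\sum_(i < d) k i) 2%N) =
       4%:Z * ((\sum_(i < d | (i < 2)%N) (k i)%:Z) - \sum_(i < d | (2 <= i)%N) (k i)%:Z)
       + 2%:Z * d%:Z - 1) /\
  ((4 <= d)%N ->
   (exists i : 'I_d, (2 <= i)%N /\ forall j : 'I_d, (lam j <= lam i)%N) ->
   ~ e_positive (X_spider lam)).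
Proof.
move=> d_ge2 lam_odd lam_even _; split; first exact: X_spider_e_expansion.
split=> [c|d_ge4 [i [i2 lam_max]] e_pos].
  exact: e_coef_odd_odd_even d_ge2 lam_odd lam_even c.
have [[c [cX c_ge0]] sizeN] := (e_pos, spider_size_odd_odd_even d_ge2 lam_odd lam_even).
have [ki_gt0 lam_i] := lam_even i i2.
set K := (\sum_(j < d) k j)%N in sizeN.
have ki_le : (k i <= K)%N by rewrite /K (bigD1 i) //= leq_addr.
(* The legs have 2K + 2 vertices in all, so [long] says that leg [i] has at least as many as the
   others together. In the other case a = K + 1. *)
have [short|long] := leqP (lam i) K.
  apply: (@not_e_positive_short_legs d lam K.+1) e_pos => [||j]; [lia|lia|].
  by rewrite ltnS (leq_trans (lam_max j)).
have Kparts : K = (\sum_(j < d | j < 2) k j + \sum_(j < d | 2 <= j) k j)%N.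
  rewrite /K (bigID (fun j : 'I_d => j < 2)%N) /=; congr (_ + _)%N.
  by apply: eq_bigl => j; rewrite -leqNgt.
have even_ge := sum_even_legs_ge i2 (fun j j2 => (lam_even j j2).1).
have := e_coef_odd_odd_even d_ge2 lam_odd lam_even cX.
have -> : \sum_(j < d | (j < 2)%N) (k j)%:Z = (\sum_(j < d | j < 2) k j)%N.
  by rewrite (big_morph Posz PoszD (erefl _)).
have -> : \sum_(j < d | (2 <= j)%N) (k j)%:Z = (\sum_(j < d | 2 <= j) k j)%N.
  by rewrite (big_morph Posz PoszD (erefl _)).
rewrite -/K; have [t t_ok <-] := part_of_three_twos sizeN.
(* Let A and B be the sums of k_j over the odd and the even legs. From 2 k_i >= A + B + 1 and B >=
   k_i + d - 3 the coefficient is at most 19 - 6d, which is negative for d >= 4. *)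
have := c_ge0 t t_ok; move: (c _) => ct; lia.
Qed.
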